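(* Let $\kappa:\mathbb{R}^n\to\mathbb{R}\cup\{+\infty\}$ and $\rho:\mathbb{R}^m\to\mathbb{R}\cup\{+\infty\}$ be closed gauges, $A:\mathbb{R}^n\to\mathbb{R}^m$ linear, $b\in\mathbb{R}^m$, $\sigma\ge0$, with $\rho(b)>\sigma$. Suppose both the gauge primal $(G_p)$ and gauge dual $(G_d)$ are relatively strictly feasible, and that the pair $(x^*,y^* )$ is primal-dual feasible. Then $(x^*,y^* )$ is primal-dual optimal (i.e. $x^*$ is optimal for $(G_p)$ and $y^*$ is optimal for $(G_d)$) if and only if it satisfies all of the conditions (a) $\rho(b-Ax^* )=\sigma$ or $\rho^\circ(y^* )=0$; (b) $\langle b,y^*\rangle-\sigma\rho^\circ(y^* )=1$; (c) $\langle x^*,A^Ty^*\rangle=\kappa(x^* )\cdot\kappa^\circ(A^Ty^* )$; (d) $\langle b-Ax^*,y^*\rangle=\sigma\rho^\circ(y^* )$.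
   Context: A gauge is a convex function into $\mathbb{R}\cup\{+\infty\}$ that is nonnegative, positively homogeneous, and vanishes at the origin; closed means lower semicontinuous. The polar of a gauge $\kappa$ is $\kappa^\circ(y)=\inf\{\mu>0\mid\langle x,y\rangle\le\mu\kappa(x)\ \forall x\}$ (with $\inf\emptyset=+\infty$). $\operatorname{dom}h=\{h<+\infty\}$, and $\delta_C$ is the $0/{+\infty}$ indicator of $C$. Problems: $(G_p)$: minimize $\kappa(x)$ subject to $\rho(b-Ax)\le\sigma$. $(G_d)$: minimize $\kappa^\circ(A^Ty)$ subject to $\langle b,y\rangle-\sigma\rho^\circ(y)\ge1$. Convention: when $\sigma=0$, $\sigma\rho^\circ$ means $\delta_{\operatorname{cl}\operatorname{dom}\rho^\circ}$ everywhere it occurs. Feasible sets: $\mathcal{F}_p=\{u\mid\rho(b-u)\le\sigma\}$, $\mathcal{F}_d=\{y\mid\langle b,y\rangle-\sigma\rho^\circ(y)\ge1\}$. $(x^*,y^* )$ is primal-dual feasible if $x^*\in\operatorname{dom}\kappa$, $Ax^*\in\mathcal{F}_p$, $y^*\in\mathcal{F}_d$ and $A^Ty^*\in\operatorname{dom}\kappa^\circ$. $(G_p)$ is relatively strictly feasible if $A^{-1}(\operatorname{ri}\mathcal{F}_p)\cap\operatorname{ri}\operatorname{dom}\kappa\neq\emptyset$; $(G_d)$ is relatively strictly feasible if $A^T(\operatorname{ri}\mathcal{F}_d)\cap\operatorname{ri}\operatorname{dom}\kappa^\circ\ne\emptyset$. *)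

(* Defs.v *)
From mathcomp Require Import all_boot all_order all_algebra.
From mathcomp Require Import all_classical all_reals all_analysis.
Import Order.TTheory GRing.Theory Num.Theory.
Import numFieldNormedType.Exports.

Set Implicit Arguments.
Unset Strict Implicit.
Unset Printing Implicit Defensive.

Local Open Scope classical_set_scope.
Local Open Scope ring_scope.

Definition dotp (R : realType) (n : nat) (x y : 'cV[R]_n) : R :=
  \sum_(i < n) x i 0 * y i 0.

Definition edom (R : realType) (T : Type) (f : T -> \bar R) : set T :=
  [set x | (f x < +oo)%E].

(* the convex-analysis indicator (0 or +oo), not the {0,1}-valued \1_C *)
Definition delta (R : realType) (T : Type) (C : set T) (x : T) : \bar R :=
  if `[< C x >] then 0%E else +oo%E.

Definition affine_set (R : realType) (n : nat) (M : set 'cV[R]_n) : Prop :=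
  forall (x y : 'cV[R]_n) (t : R), M x -> M y -> M (t *: x + (1 - t) *: y).

Definition affine_hull (R : realType) (n : nat) (C : set 'cV[R]_n) :
    set 'cV[R]_n :=
  smallest (@affine_set R n) C.

Definition relint (R : realType) (n : nat) (C : set 'cV[R]_n) : set 'cV[R]_n :=
  [set x | affine_hull C x /\ within (affine_hull C) (nbhs x) C].

(* Restricting t to ]0, 1[ keeps 0 * +oo out of the convexity inequality.
   Nonnegativity excludes the value -oo. *)
Record gauge (R : realType) (n : nat) (f : 'cV[R]_n -> \bar R) : Prop := {
  gauge_convex : forall (x y : 'cV[R]_n) (t : R), 0 < t -> t < 1 ->
    (f (t *: x + (1 - t) *: y)%R <= t%:E * f x + (1 - t)%R%:E * f y)%E;
  gauge_ge0 : forall x : 'cV[R]_n, (0 <= f x)%E;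
  gauge_homog : forall (t : R) (x : 'cV[R]_n), 0 < t ->
    f (t *: x) = (t%:E * f x)%E;
  gauge_0 : f 0 = 0%E }.

Definition closed_gauge (R : realType) (n : nat) (f : 'cV[R]_n -> \bar R) :
    Prop :=
  gauge f /\ lower_semicontinuous f.

Definition polar (R : realType) (n : nat) (f : 'cV[R]_n -> \bar R)
    (y : 'cV[R]_n) : \bar R :=
  ereal_inf [set mu%:E | mu in [set mu : R | 0 < mu /\
    forall x : 'cV[R]_n, ((dotp x y)%:E <= mu%:E * f x)%E]].

(* sigma * polar rho, read as the indicator of cl (dom (polar rho)) when
   sigma = 0 *)
Definition scaled_polar (R : realType) (m : nat) (sigma : R)
    (rho : 'cV[R]_m -> \bar R) (y : 'cV[R]_m) : \bar R :=
  if sigma == 0 then delta R (closure (edom (polar rho))) y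
  else (sigma%:E * polar rho y)%E.

Section GaugePair.
Variables (R : realType) (m n : nat).
Variables (kappa : 'cV[R]_n -> \bar R) (rho : 'cV[R]_m -> \bar R).
Variables (A : 'M[R]_(m, n)) (b : 'cV[R]_m) (sigma : R).

Definition Fp : set 'cV[R]_m := [set u | (rho (b - u)%R <= sigma%:E)%E].

Definition Fd : set 'cV[R]_m :=
  [set y | (1 <= (dotp b y)%:E - scaled_polar sigma rho y)%E].

Definition primal_dual_feasible (x : 'cV[R]_n) (y : 'cV[R]_m) : Prop :=
  [/\ edom kappa x, Fp (A *m x), Fd y & edom (polar kappa) (A^T *m y)].

Definition primal_relatively_strictly_feasible : Prop :=
  (mulmx A @^-1` relint Fp) `&` relint (edom kappa) !=set0.

Definition dual_relatively_strictly_feasible : Prop :=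
  (mulmx A^T @` relint Fd) `&` relint (edom (polar kappa)) !=set0.

Definition primal_optimal (x : 'cV[R]_n) : Prop :=
  Fp (A *m x) /\
  forall z : 'cV[R]_n, Fp (A *m z) -> (kappa x <= kappa z)%E.

Definition dual_optimal (y : 'cV[R]_m) : Prop :=
  Fd y /\
  forall z : 'cV[R]_m, Fd z ->
    (polar kappa (A^T *m y) <= polar kappa (A^T *m z))%E.

End GaugePair.

(* Main.v *)
(** The scaled polar is the support function of the sublevel set [rho <= sigma]
    (for [sigma = 0] this is the bipolar theorem), so [w] is dual feasible iff
    [<u, w> >= 1] on [Fp]; hence [kappa x * polar kappa (A^T y) >= 1] for every
    primal-dual feasible pair. Relative strict feasibility of the primal yields
    a Lagrange multiplier [w] with [<A x, w> <= kappa x] everywhere and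
    [<u, w> >= p] on [Fp], where [p > 0] is the primal value. Then [w / p] is
    dual feasible with value at most [1 / p], so optimal pairs are exactly those
    whose product of values is 1, and (a)-(d) express equality along the chain
    of weak duality inequalities. *)
Require Import Defs.
From mathcomp Require Import all_boot all_order all_algebra.
From mathcomp Require Import all_classical all_reals all_analysis.
From mathcomp Require Import ring lra.
Import Order.TTheory GRing.Theory Num.Theory.
Import numFieldNormedType.Exports.
Set Implicit Arguments.
Unset Strict Implicit.
Unset Printing Implicit Defensive.

Local Open Scope classical_set_scope.
Local Open Scope ring_scope.

(** * Bilinearity of the inner product *)

Lemma dotpC (R : realType) n (x y : 'cV[R]_n) : dotp x y = dotp y x.
Proof. by apply: eq_bigr => i _; rewrite mulrC. Qed.

Lemma dotpDl (R : realType) n (x y z : 'cV[R]_n) :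
  dotp (x + y) z = dotp x z + dotp y z.
Proof. by rewrite -big_split; apply: eq_bigr => i _; rewrite mxE mulrDl. Qed.

Lemma dotpZl (R : realType) n (t : R) (x z : 'cV[R]_n) :
  dotp (t *: x) z = t * dotp x z.
Proof.
by rewrite [RHS]big_distrr; apply: eq_bigr => i _; rewrite mxE -mulrA.
Qed.

Lemma dotpNl (R : realType) n (x z : 'cV[R]_n) : dotp (- x) z = - dotp x z.
Proof. by rewrite -scaleN1r dotpZl mulN1r. Qed.

Lemma dotpBl (R : realType) n (x y z : 'cV[R]_n) :
  dotp (x - y) z = dotp x z - dotp y z.
Proof. by rewrite dotpDl dotpNl. Qed.

Lemma dotp0l (R : realType) n (z : 'cV[R]_n) : dotp 0 z = 0.
Proof. by rewrite -(scale0r 0) dotpZl mul0r. Qed.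

Lemma dotpDr (R : realType) n (x y z : 'cV[R]_n) :
  dotp z (x + y) = dotp z x + dotp z y.
Proof. by rewrite dotpC dotpDl !(dotpC z). Qed.

Lemma dotpZr (R : realType) n (t : R) (x z : 'cV[R]_n) :
  dotp z (t *: x) = t * dotp z x.
Proof. by rewrite dotpC dotpZl dotpC. Qed.

Lemma dotp_delta (R : realType) n (x : 'cV[R]_n) (k : 'I_n) :
  dotp x (delta_mx k 0) = x k 0.
Proof.
rewrite /dotp (bigD1 k)//= mxE !eqxx mulr1 big1 ?addr0// => i ik.
by rewrite mxE (negbTE ik) mulr0.
Qed.

Lemma dotp_mulmx (R : realType) m n (A : 'M[R]_(m, n)) x y :
  dotp (A *m x) y = dotp x (A^T *m y).
Proof.
have dotE k (u v : 'cV[R]_k) : dotp u v = (u^T *m v) 0 0.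
  by rewrite mxE; apply: eq_bigr => i _; rewrite mxE.
by rewrite !dotE trmx_mul mulmxA.
Qed.

(** * Linear functionals supporting a cone, and separation of a point from a convex set *)

Section ConeSupport.
Context {R : realType} {m : nat}.
Implicit Types (K : 'cV[R]_m -> R -> Prop) (d z : 'cV[R]_m).

(** A finite-dimensional Hahn-Banach argument by induction on [k], the number of leading coordinates
    in which directions of [K] may be nonzero. The slice where the last of these vanishes gives
    [z0]; only that one coordinate of [z] remains to be chosen. *)
Lemma cone_support_coord (k : nat) K :
  (forall d d' r r', K d r -> K d' r' -> K (d + d') (r + r')) ->
  (forall d r t, 0 < t -> K d r -> K (t *: d) (t * r)) ->
  (forall r, K 0 r -> 0 <= r) ->
  (forall d r, K d r -> exists r', K (- d) r') ->
  (forall d r (i : 'I_m), K d r -> (k <= i)%N -> d i 0 = 0) ->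
  exists z, forall d r, K d r -> dotp d z <= r.
Proof.
elim: k K => [|k IH] K KD KZ K0 KN Ksupp.
  exists 0 => d r Kdr; rewrite dotpC dotp0l.
  suff d0 : d = 0 by apply: K0; rewrite -d0.
  by apply/colP => i; rewrite mxE (Ksupp _ _ i Kdr).
have [km|mk] := ltnP k m; last first.
  apply: (IH K) => // d r i _ ki.
  by have := leq_trans mk ki; rewrite leqNgt ltn_ord.
pose i0 := Ordinal km.
have [z0 Hz0] : exists z, forall d r, (d i0 0 = 0 /\ K d r) -> dotp d z <= r.
  apply: (IH (fun d r => d i0 0 = 0 /\ K d r)).
  - move=> d d' r r' [d0 Kd] [d0' Kd']; split; last exact: KD.
    by rewrite mxE d0 d0' addr0.
  - by move=> d r t t0 [d0 Kd]; split; [rewrite mxE d0 mulr0|exact: KZ].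
  - by move=> r [_]; exact: K0.
  - move=> d r [d0 Kd]; have [r' Kr'] := KN _ _ Kd.
    by exists r'; split=> //; rewrite mxE d0 oppr0.
  - move=> d r i [d0 Kd]; rewrite leq_eqVlt => /orP[/eqP ki|];
      last exact: Ksupp Kd.
    by rewrite -[RHS]d0; congr (d _ _); apply: val_inj.
have Knorm d r : K d r -> d i0 0 != 0 ->
    K (`|d i0 0|^-1 *: d) (`|d i0 0|^-1 * r).
  by move=> Kd d0; apply: KZ => //; rewrite invr_gt0 normr_gt0.
have [[e [re [Ke e1]]]|noK] := pselect (exists d r, K d r /\ d i0 0 = 1);
  last first.
  (* A nonzero coordinate could be scaled to 1, after negating the direction if it is negative; so
     here all of [K] lies in the slice. *)
  exists z0 => d r Kd; apply: Hz0; split=> //; apply: contrapT => /eqP d0.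
  apply: noK; case: (ltgtP (d i0 0) 0) d0 => // dn _.
  - have [r' Kr'] := KN _ _ Kd.
    have := Knorm _ _ Kr'; rewrite mxE oppr_eq0 lt_eqF// => /(_ isT) H.
    eexists; eexists; split; first exact: H.
    by rewrite !mxE normrN ltr0_norm// mulVf// oppr_eq0 lt_eqF.
  - have := Knorm _ _ Kd; rewrite gt_eqF// => /(_ isT) H.
    eexists; eexists; split; first exact: H.
    by rewrite !mxE gtr0_norm// mulVf// gt_eqF.
(* Directions with coordinate -1 bound the missing coordinate of [z] from below, those with
   coordinate 1 from above. Adding one of each lands in the slice, where [z0] shows the bounds to be
   compatible; [sup L] meets them all. *)
pose L := [set l | exists d r, [/\ K d r, d i0 0 = -1 & l = dotp d z0 - r]].
have Lub d r : K d r -> d i0 0 = 1 -> ubound L (r - dotp d z0).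
  move=> Kd d1 _ [d' [r' [Kd' d1' ->]]].
  have : dotp (d + d') z0 <= r + r'.
    by apply: Hz0; split; [rewrite mxE d1 d1' subrr|exact: KD].
  by rewrite dotpDl => H; lra.
have Lne : L !=set0.
  have [r' Kr'] := KN _ _ Ke.
  by exists (dotp (- e) z0 - r'), (- e), r'; split=> //; rewrite mxE e1.
have Lbd : has_ubound L by exists (re - dotp e z0); exact: Lub.
exists (z0 + sup L *: delta_mx i0 0) => d r Kd.
rewrite dotpDr dotpZr dotp_delta.
have [d0|d0|d0] := ltgtP (d i0 0) 0; last 1 first.
- by rewrite d0 mulr0 addr0; exact: Hz0.
- have p0 : 0 < `|d i0 0| by rewrite normr_gt0 lt_eqF.
  have /(ub_le_sup Lbd) : L (dotp (`|d i0 0|^-1 *: d) z0 - `|d i0 0|^-1 * r).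
    exists (`|d i0 0|^-1 *: d), (`|d i0 0|^-1 * r); split=> //.
      by apply: Knorm; rewrite ?lt_eqF.
    by rewrite mxE ltr0_norm// invrN mulNr mulVf// lt_eqF.
  rewrite dotpZl -mulrBr ler_pdivrMl// ltr0_norm// => H; lra.
- have p0 : 0 < `|d i0 0| by rewrite normr_gt0 gt_eqF.
  have : sup L <= `|d i0 0|^-1 * r - dotp (`|d i0 0|^-1 *: d) z0.
    apply: ge_sup Lne _; apply: Lub.
      by apply: Knorm; rewrite ?gt_eqF.
    by rewrite mxE gtr0_norm// mulVf// gt_eqF.
  rewrite dotpZl -mulrBr ler_pdivlMl// gtr0_norm// => H; lra.
Qed.

Lemma cone_support K :
  (forall d d' r r', K d r -> K d' r' -> K (d + d') (r + r')) ->
  (forall d r t, 0 < t -> K d r -> K (t *: d) (t * r)) ->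
  (forall r, K 0 r -> 0 <= r) ->
  (forall d r, K d r -> exists r', K (- d) r') ->
  exists z, forall d r, K d r -> dotp d z <= r.
Proof.
move=> KD KZ K0 KN; apply: (@cone_support_coord m) => // d r i _.
by rewrite leqNgt ltn_ord.
Qed.

End ConeSupport.

(** Merges two multiples of points of [C] into one, which makes the cones built over convex sets
    below closed under addition. *)
Lemma convex_conic_comb (R : realType) n (C : set 'cV[R]_n) :
  (forall x y t, 0 < t -> t < 1 -> C x -> C y -> C (t *: x + (1 - t) *: y)) ->
  forall t1 t2 x1 x2, 0 <= t1 -> 0 <= t2 -> C x1 -> C x2 ->
  exists2 x, C x & t1 *: x1 + t2 *: x2 = (t1 + t2) *: x.
Proof.
move=> Cc t1 t2 x1 x2; rewrite le0r => /orP[/eqP ->|t10].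
  by exists x2 => //; rewrite scale0r !add0r.
rewrite le0r => /orP[/eqP ->|t20] C1 C2.
  by exists x1 => //; rewrite scale0r !addr0.
have t120 : 0 < t1 + t2 by exact: addr_gt0.
exists (t1 / (t1 + t2) *: x1 + (1 - t1 / (t1 + t2)) *: x2).
  by apply: Cc => //; rewrite ?divr_gt0// ltr_pdivrMr// mul1r ltrDl.
rewrite scalerDr !scalerA; congr (_ *: _ + _ *: _); field; exact: lt0r_neq0.
Qed.

(* Cone generated by [(c - v, -1)] and [(a, `|a| / e)]: it meets the vertical
   axis only above 0 because [C] misses the ball of radius [e] around [v]. *)
Lemma convex_separation (R : realType) n (C : set 'cV[R]_n) (v : 'cV[R]_n) :
  (forall x y t, 0 < t -> t < 1 -> C x -> C y -> C (t *: x + (1 - t) *: y)) ->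
  C !=set0 -> ~ closure C v ->
  exists z, forall c, C c -> dotp c z <= dotp v z - 1.
Proof.
move=> Cc [c0 Cc0] nCv.
have [e e0 He] : exists2 e : R, 0 < e & forall c, C c -> e <= `|c - v|.
  apply: contrapT => H; apply: nCv => U /nbhs_ballP [e /= e0 eU].
  apply: contrapT => CU; apply: H; exists e => // c Cc'.
  rewrite leNgt; apply/negP => cv; apply: CU; exists c; split=> //; apply: eU.
  by rewrite mx_norm_ball /ball_ /= distrC.
pose K (d : 'cV[R]_n) (r : R) := exists t s c a,
  [/\ 0 <= t, C c, `|a| <= e * s, d = t *: (c - v) + a & r = - t + s].
have [||||z Hz] := @cone_support _ _ K.
- move=> _ _ _ _ [t [s [c [a [t0 C1 ha -> ->]]]]]
    [t' [s' [c' [a' [t0' C1' ha' -> ->]]]]].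
  have [x Cx Hx] := convex_conic_comb Cc t0 t0' C1 C1'.
  exists (t + t'), (s + s'), x, (a + a'); split=> //.
  + exact: addr_ge0.
  + by rewrite mulrDr (le_trans (ler_normD _ _))// lerD.
  + rewrite !scalerBr -Hx scalerDl opprD [LHS]addrACA; congr (_ + _).
    exact: addrACA.
  + by rewrite opprD addrACA.
- move=> _ _ u u0 [t [s [c [a [t0 C1 ha -> ->]]]]].
  exists (u * t), (u * s), c, (u *: a); split=> //.
  + by rewrite mulr_ge0// ltW.
  + by rewrite normrZ gtr0_norm// mulrCA ler_pM2l.
  + by rewrite scalerDr scalerA.
  + by rewrite mulrDr mulrN.
- move=> _ [t [s [c [a [t0 C1 ha /esym/eqP + ->]]]]].
  rewrite addrC addr_eq0 => /eqP aE.
  move: ha; rewrite aE normrN normrZ ger0_norm// => ha.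
  have := ler_wpM2l t0 (He _ C1) => H.
  have : e * t <= e * s by rewrite mulrC; exact: le_trans ha.
  by rewrite ler_pM2l// => ?; rewrite addrC subr_ge0.
- move=> _ _ [t [s [c [a [t0 C1 ha -> _]]]]].
  exists (`|t *: (c - v) + a| / e), 0, (`|t *: (c - v) + a| / e), c0.
  exists (- (t *: (c - v) + a)); split=> //.
  + by rewrite normrN mulrCA divff ?lt0r_neq0// mulr1.
  + by rewrite scale0r add0r.
  + by rewrite oppr0 add0r.
exists z => c Cc1.
have : dotp (c - v) z <= -1.
  apply: Hz; exists 1, 0, c, 0; split=> //.
  + by rewrite normr0 mulr0.
  + by rewrite scale1r addr0.
  + by rewrite addr0.
by rewrite dotpBl => H; lra.
Qed.

(** * Gauges and their polars *)

Section Gauge.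
Context {R : realType} {n : nat} {f : 'cV[R]_n -> \bar R}.
Hypothesis gf : gauge f.
Implicit Types (x y w : 'cV[R]_n).

Lemma gauge_finP x : (f x < +oo)%E -> exists2 r : R, f x = r%:E & 0 <= r.
Proof.
have := gauge_ge0 gf x; case: (f x) => [r| |]//= r0 _.
by exists r => //; rewrite -lee_fin.
Qed.

Lemma gauge_le_finP x (a : R) : (f x <= a%:E)%E ->
  exists2 r : R, f x = r%:E & 0 <= r <= a.
Proof.
move=> fa; have [r fr r0] := gauge_finP (le_lt_trans fa (ltry a)).
by exists r => //; rewrite r0 -lee_fin -fr.
Qed.

Lemma gaugeZ (t : R) x (r : R) : 0 < t -> f x = r%:E -> f (t *: x) = (t * r)%:E.
Proof. by move=> t0 fx; rewrite gauge_homog// fx EFinM. Qed.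

Lemma gaugeD_le x y (r s : R) :
  f x = r%:E -> f y = s%:E -> (f (x + y) <= (r + s)%:E)%E.
Proof.
move=> fx fy.
(* Subadditivity is midpoint convexity at [2x] and [2y]. *)
have := gauge_convex gf (2%:R *: x) (2%:R *: y) (t := 2^-1).
rewrite !scalerA (gaugeZ _ fx)// (gaugeZ _ fy)// -!EFinM -EFinD.
rewrite (_ : 1 - 2^-1 = 2^-1 :> R); last by lra.
rewrite !mulVf// !scale1r !mulrA !mulVf// !mul1r; apply; lra.
Qed.

Lemma gauge_le_convex (a : R) x y (t : R) : 0 < t -> t < 1 ->
  (f x <= a%:E)%E -> (f y <= a%:E)%E -> (f (t *: x + (1 - t) *: y) <= a%:E)%E.
Proof.
move=> t0 t1 /gauge_le_finP[r fr /andP[_ ra]] /gauge_le_finP[s fs /andP[_ sa]].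
apply: le_trans (gauge_convex gf _ _ t0 t1) _.
by rewrite fr fs -!EFinM -EFinD lee_fin; nra.
Qed.

Lemma polar_ge0 y : (0 <= polar f y)%E.
Proof.
by apply: le_ereal_inf_tmp => _ [mu [mu0 _] <-]; rewrite lee_fin ltW.
Qed.

Lemma polar_finP y : (polar f y < +oo)%E ->
  exists2 q : R, polar f y = q%:E & 0 <= q.
Proof.
have := polar_ge0 y; case: (polar f y) => [r| |]//= r0 _.
by exists r => //; rewrite -lee_fin.
Qed.

(** The infimum ranges over positive multipliers, so [mu = 0] is only approached, through [mu + e];
    positivity of [mu + e] also settles the points where [f] is infinite. *)
Lemma polar_le y (mu : R) : 0 <= mu ->
  (forall x r, f x = r%:E -> dotp x y <= mu * r) -> (polar f y <= mu%:E)%E.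
Proof.
move=> mu0 H; apply/lee_addgt0Pr => e e0; rewrite -EFinD.
apply: ereal_inf_lbound; exists (mu + e) => //.
split=> [|x]; first exact: ltr_wpDl.
have := gauge_ge0 gf x; case E : (f x) => [r| |]//; last first.
  by rewrite gt0_muley ?leey// lte_fin ltr_wpDl.
rewrite -EFinM !lee_fin => r0.
by rewrite (le_trans (H _ _ E))// ler_wpM2r// lerDl ltW.
Qed.

Lemma dotp_le_polar x y (r q : R) : f x = r%:E -> polar f y = q%:E ->
  dotp x y <= r * q.
Proof.
move=> fx fy.
have r0 : 0 <= r by rewrite -lee_fin -fx gauge_ge0.
apply/ler_addgt0Pr => e e0.
(* This slack costs at most [e] after multiplication by [r], including when [r = 0]. *)
have e0' : 0 < e / (r + 1) by rewrite divr_gt0// ltr_wpDl.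
have [|_ [mu [mu0 H] <-]] :=
  @lb_ereal_inf_adherent R _ _ e0' (_ : polar f y \is a fin_num).
  by rewrite fy.
rewrite -/(polar f y) fy -EFinD lte_fin => muq.
have := H x; rewrite fx -EFinM lee_fin => /le_trans; apply.
have : r * mu <= r * (q + e / (r + 1)) by rewrite ler_wpM2l// ltW.
rewrite mulrC => /le_trans; apply.
rewrite mulrDr lerD2l mulrCA ler_piMr ?(ltW e0)//.
by rewrite ler_pdivrMr ?mul1r ?lerDl// ltr_wpDl.
Qed.

(** By homogeneity, [x] can be rescaled to the level [f = a]. If [f x = 0], all positive multiples
    of [x] lie in the sublevel set, so [dotp x w] cannot be positive. *)
Lemma polar_le_support (a M : R) w : 0 < a ->
  (forall v, (f v <= a%:E)%E -> dotp v w <= M) -> (polar f w <= (M / a)%:E)%E.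
Proof.
move=> a0 H.
have M0 : 0 <= M.
  by rewrite -(dotp0l w); apply: H; rewrite gauge_0// lee_fin ltW.
apply: polar_le => [|x r fx]; first by rewrite divr_ge0// ltW.
have r0 : 0 <= r by rewrite -lee_fin -fx gauge_ge0.
move: r0; rewrite le0r => /orP[/eqP r0|r0].
  rewrite r0 mulr0 leNgt; apply/negP => d0.
  have := H ((M + 1) / dotp x w *: x).
  rewrite (gaugeZ _ fx) ?divr_gt0 ?ltr_wpDl// r0 mulr0 lee_fin => /(_ (ltW a0)).
  by rewrite dotpZl divfK ?lt0r_neq0// => H1; lra.
have := H (a / r *: x); rewrite (gaugeZ _ fx) ?divr_gt0// divfK ?lt0r_neq0//.
rewrite lexx dotpZl => /(_ isT) H1.
have -> : M / a * r = M / (a / r) by field; rewrite !lt0r_neq0.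
by rewrite ler_pdivlMr ?divr_gt0// mulrC.
Qed.

Lemma polar_convex y z (t : R) : 0 < t -> t < 1 ->
  edom (polar f) y -> edom (polar f) z ->
  edom (polar f) (t *: y + (1 - t) *: z).
Proof.
move=> t0 t1 /polar_finP[q fq q0] /polar_finP[q' fq' q0'].
apply: le_lt_trans (ltry (t * q + (1 - t) * q')); apply: polar_le => [|x r fx].
  by rewrite addr_ge0// mulr_ge0// ?subr_ge0 ltW.
rewrite dotpDr !dotpZr [leRHS]mulrDl -!mulrA lerD// ler_pM2l ?subr_gt0//.
  by rewrite mulrC; exact: dotp_le_polar.
by rewrite mulrC; exact: dotp_le_polar.
Qed.

Lemma edom_polarZ y (t : R) : 0 < t ->
  edom (polar f) y -> edom (polar f) (t *: y).
Proof.
move=> t0 /polar_finP[q fq q0]; apply: le_lt_trans (ltry (t * q)).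
apply: polar_le => [|x r fx]; first by rewrite mulr_ge0// ltW.
by rewrite dotpZr -mulrA ler_pM2l// mulrC; exact: dotp_le_polar.
Qed.

Lemma edom_polar0 : edom (polar f) 0.
Proof.
apply: le_lt_trans (ltry 0); apply: polar_le => // x r fx.
by rewrite dotpC dotp0l mul0r.
Qed.

End Gauge.

(* Bipolarity: a sublevel set of [f] missing [v] is separated from [v]. *)
Lemma closed_gauge_polar_gt0 (R : realType) n (f : 'cV[R]_n -> \bar R) v :
  closed_gauge f -> (0 < f v)%E ->
  exists2 w, edom (polar f) w & 0 < dotp v w.
Proof.
move=> [gf lf] fv0.
have [a a0 fva] : exists2 a : R, 0 < a & (a%:E < f v)%E.
  move: fv0; case: (f v) => [r| |]//; last by exists 1 => //; rewrite ltry.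
  by rewrite lte_fin => r0; exists (r / 2); rewrite ?lte_fin; lra.
have [|||w Hw] := @convex_separation _ _ [set x | (f x <= a%:E)%E] v.
- move=> x y t; exact: gauge_le_convex.
- by exists 0; rewrite /= gauge_0// lee_fin ltW.
- have [V nV VP] := lf v a fva; move=> /(_ V nV)[x [/= fxa /VP]].
  by rewrite ltNge fxa.
exists w.
  by apply: le_lt_trans (ltry _); exact: (polar_le_support gf a0 Hw).
have := Hw 0; rewrite /= gauge_0// lee_fin dotp0l => /(_ (ltW a0)) H; lra.
Qed.

Lemma dotp_le0_closure (R : realType) m (C : set 'cV[R]_m) (v w : 'cV[R]_m) :
  (forall w', C w' -> dotp v w' <= 0) -> closure C w -> dotp v w <= 0.
Proof.
move=> HC Cw; rewrite leNgt; apply/negP => d0.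
(* [M - 1] is a Lipschitz constant of [dotp v] for the max norm. Within distance [dotp v w / M] of
   [w] the pairing with [v] therefore stays positive. *)
pose M := \sum_(i < m) `|v i 0| + 1.
have M0 : 0 < M by rewrite ltr_wpDl// sumr_ge0.
have e0 : 0 < dotp v w / M by exact: divr_gt0.
have [w' [Cw' [_ ball_ww']]] := Cw _ (nbhsx_ballx w _ e0).
have : dotp v w - dotp v w' <= (M - 1) * (dotp v w / M).
  rewrite /M addrK big_distrl -sumrB; apply: ler_sum => i _ /=.
  rewrite -mulrBr (le_trans (ler_norm _))// normrM ler_wpM2l// ltW//.
  exact: (ball_ww' i 0).
rewrite mulrBl mul1r mulrCA divff ?lt0r_neq0// mulr1 => H.
have := HC _ Cw'; lra.
Qed.

(** * The scaled polar as a support function, and dual feasibility *)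

Section ScaledPolar.
Context {R : realType} {m : nat} {rho : 'cV[R]_m -> \bar R} {sigma : R}.
Hypotheses (hrho : closed_gauge rho) (sigma0 : 0 <= sigma).
Implicit Types (v w : 'cV[R]_m).

Let grho : gauge rho := hrho.1.

Lemma scaled_polar_ge0 w : (0 <= scaled_polar sigma rho w)%E.
Proof.
rewrite /scaled_polar /delta; case: ifP => _; first by case: ifP.
by rewrite mule_ge0 ?lee_fin ?polar_ge0.
Qed.

(** For [sigma = 0], [rho v = 0] makes the pairing with [v] nonpositive on the domain of the polar,
    hence on its closure. *)
Lemma dotp_le_scaled_polar v w :
  (rho v <= sigma%:E)%E -> ((dotp v w)%:E <= scaled_polar sigma rho w)%E.
Proof.
move=> /(gauge_le_finP grho)[r rv /andP[r0 rs]].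
rewrite /scaled_polar; case: eqVneq => [s0|sn0].
  rewrite /delta; case: asboolP => [|_]; last by rewrite leey.
  rewrite lee_fin; apply: dotp_le0_closure => w' /(polar_finP)[q fq _].
  rewrite (le_trans (dotp_le_polar grho rv fq))//.
  by rewrite (_ : r = 0) ?mul0r//; apply/le_anti; rewrite r0 -s0 rs.
have [pw|] := ltP (polar rho w) +oo%E; last first.
  by rewrite leye_eq => /eqP ->; rewrite gt0_muley ?leey// lte_fin lt0r sn0.
have [q fq q0] := polar_finP pw.
rewrite fq -EFinM lee_fin (le_trans (dotp_le_polar grho rv fq))//.
by rewrite ler_wpM2r.
Qed.

Lemma scaled_polar_le_support (M : R) w :
  (forall v, (rho v <= sigma%:E)%E -> dotp v w <= M) ->
  (scaled_polar sigma rho w <= M%:E)%E.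
Proof.
move=> HM.
have M0 : 0 <= M by rewrite -(dotp0l w); apply: HM; rewrite gauge_0// lee_fin.
rewrite /scaled_polar; case: eqVneq => [s0|sn0]; last first.
  have sp : 0 < sigma by rewrite lt0r sn0.
  have := polar_le_support grho sp HM => H.
  apply: le_trans (lee_wpmul2l _ H) _; first by rewrite lee_fin.
  by rewrite -EFinM lee_fin mulrC divfK.
rewrite /delta; case: asboolP => [_|ncl]; first by rewrite lee_fin.
exfalso.
(* For [sigma = 0], a [w] outside the closed domain of the polar is separated from it by [z]. The
   aim is [rho z = 0], so that multiples of [z] violate the bound [M]. *)
have [||z Hz] := @convex_separation _ _ _ _ _ _ ncl.
- by move=> w1 w2 t; exact: polar_convex.
- by exists 0; exact: edom_polar0.
have wz1 : 1 <= dotp w z.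
  by have := Hz _ (edom_polar0 grho); rewrite dotp0l => H; lra.
have wz0 : 0 < dotp w z by lra.
have rz : rho z = 0%E.
  apply/eqP; rewrite eq_le gauge_ge0// andbT leNgt; apply/negP.
  move=> /(closed_gauge_polar_gt0 hrho)[w' dw' zw'].
  (* The domain of the polar is a cone: [w'] is rescaled to pair with [z] exactly as [w] does,
     contradicting the gap of 1. *)
  have := Hz _ (edom_polarZ grho (divr_gt0 wz0 zw') dw').
  by rewrite dotpZl (dotpC w') divfK ?lt0r_neq0// => H; lra.
have t0 : 0 < (M + 1) / dotp w z by rewrite divr_gt0// ltr_wpDl.
have := HM ((M + 1) / dotp w z *: z).
rewrite gauge_homog// rz mule0 lee_fin => /(_ sigma0).
by rewrite dotpZl (dotpC z) divfK ?lt0r_neq0// => H; lra.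
Qed.

(** Substituting [v = b - u] turns the right side into [1 <= dotp u w] on [Fp]. An infinite scaled
    polar makes the difference -oo, so it cannot satisfy [Fd]. *)
Lemma Fd_supportP (b : 'cV[R]_m) w : Fd rho b sigma w <->
  forall v, (rho v <= sigma%:E)%E -> dotp v w <= dotp b w - 1.
Proof.
rewrite /Fd /=; split=> [Fw v rv|/scaled_polar_le_support].
  have := dotp_le_scaled_polar w rv.
  have := scaled_polar_ge0 w; move: Fw.
  case: scaled_polar => [s| |]//=; rewrite -EFinB !lee_fin => H _ H'; lra.
have := scaled_polar_ge0 w.
case: scaled_polar => [s| |]//=; rewrite -EFinB !lee_fin => _ H; lra.
Qed.

Lemma Fd_finP (b : 'cV[R]_m) w : Fd rho b sigma w ->
  exists2 s : R, scaled_polar sigma rho w = s%:E & 1 <= dotp b w - s.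
Proof.
rewrite /Fd /=; have := scaled_polar_ge0 w.
by case: scaled_polar => [s| |]//= _; rewrite -EFinB lee_fin; exists s.
Qed.

Lemma dual_feasible_dotp_ge1 n (A : 'M[R]_(m, n)) (b : 'cV[R]_m) x w :
  Fp rho b sigma (A *m x) -> Fd rho b sigma w -> 1 <= dotp x (A^T *m w).
Proof.
move=> Fx /Fd_supportP/(_ _ Fx); rewrite dotpBl -dotp_mulmx => H; lra.
Qed.

End ScaledPolar.

(** * Relative interiors and the Lagrange multiplier *)

Lemma relint_extend (R : realType) n (C : set 'cV[R]_n) x0 x :
  relint C x0 -> C x ->
  exists2 e : R, 0 < e & forall t, 0 < t -> t <= e -> C (x0 + t *: (x0 - x)).
Proof.
move=> [ax0 /nbhs_ballP[e /= e0 He]] Cx.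
have d0 : 0 < `|x0 - x| + 1 by rewrite ltr_wpDl.
exists (e / (`|x0 - x| + 1)); first exact: divr_gt0.
move=> t t0 te; apply: He.
  rewrite mx_norm_ball /ball_ /= opprD addNKr normrN normrZ gtr0_norm//.
  rewrite (@lt_le_trans _ _ (t * (`|x0 - x| + 1)))// ?ltr_pM2l ?ltrDl//.
  by rewrite -ler_pdivlMr.
(* The prolonged point is the affine combination of [x0] and [x] with coefficients [1 + t] and [-t],
   so it stays in the hull. *)
have ax : affine_hull C x by move=> M [_]; apply.
move=> M [aM CM] /=.
have := aM _ _ (1 + t) (ax0 _ (conj aM CM)) (ax _ (conj aM CM)).
by rewrite scalerDl scale1r opprD addNKr scaleNr scalerBr addrA.
Qed.

(* The multiplier supports, at the origin, the cone generated by the epigraph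
   of the perturbed optimal value; relative strict feasibility makes the
   projection of this cone a linear subspace. *)
Lemma gauge_multiplier (R : realType) (m n : nat) (kappa : 'cV[R]_n -> \bar R)
    (F : set 'cV[R]_m) (A : 'M[R]_(m, n)) (x0 : 'cV[R]_n) (p : R) :
  gauge kappa ->
  (forall u v t, 0 < t -> t < 1 -> F u -> F v -> F (t *: u + (1 - t) *: v)) ->
  relint F (A *m x0) -> relint (edom kappa) x0 ->
  (forall x, F (A *m x) -> (p%:E <= kappa x)%E) ->
  exists w, (forall x k, kappa x = k%:E -> dotp (A *m x) w <= k) /\
            (forall u, F u -> p <= dotp u w).
Proof.
move=> gk cF rF rk Hp.
have F0 : F (A *m x0) by case: rF => a0 /nbhs_singleton; exact.
pose K (d : 'cV[R]_m) (r : R) := exists t u x k,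
  [/\ 0 < t, F u, kappa x = k%:E, d = A *m x - t *: u & k - t * p <= r].
have KZ d r t : 0 < t -> K d r -> K (t *: d) (t * r).
  move=> t0 [s [u [x [k [s0 Fu kx -> kr]]]]].
  exists (t * s), u, (t *: x), (t * k); split=> //.
  - exact: mulr_gt0.
  - exact: gaugeZ.
  - by rewrite scalerBr -scalemxAr scalerA.
  - by rewrite -mulrA -mulrBr ler_pM2l.
have [||||w Hw] := @cone_support _ _ K.
- move=> _ _ r r' [t [u [x [k [t0 Fu kx -> kr]]]]]
    [t' [u' [x' [k' [t0' Fu' kx' -> kr']]]]].
  have [v Fv Hv] := convex_conic_comb cF (ltW t0) (ltW t0') Fu Fu'.
  have [k'' kxx' /andP[_ kk']] := gauge_le_finP gk (gaugeD_le gk kx kx').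
  exists (t + t'), v, (x + x'), k''; split=> //.
  + exact: addr_gt0.
  + by rewrite -Hv mulmxDr opprD addrACA.
  + lra.
- exact: KZ.
- move=> r [t [u [x [k [t0 Fu kx /esym/eqP + kr]]]]].
  rewrite subr_eq0 => /eqP Ax.
  (* Over the direction 0, [x / t] is primal feasible, so its value is at least [p] and
     [k >= t * p]. *)
  have ti0 : 0 < t^-1 by rewrite invr_gt0.
  have := Hp (t^-1 *: x).
  rewrite -scalemxAr Ax scalerA mulVf ?lt0r_neq0// scale1r.
  rewrite (gaugeZ gk ti0 kx) lee_fin => /(_ Fu).
  by rewrite ler_pdivlMl// => H; lra.
- move=> _ _ [t [u [x [k [t0 Fu kx -> _]]]]].
  have ti0 : 0 < t^-1 by rewrite invr_gt0.
  have dx : edom kappa (t^-1 *: x) by rewrite /edom /= (gaugeZ gk ti0 kx) ltry.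
  (* Prolong by a common [e] from [u] past [A x0] in [F], and from [x / t] past [x0] in the domain
     of [kappa]. The image of the second point minus the first is [-(e / t)] times the given
     direction; scaling by [t / e] gives its negative. *)
  have [e1 e10 H1] := relint_extend rF Fu.
  have [e2 e20 H2] := relint_extend rk dx.
  pose e := Num.min e1 e2.
  have e0 : 0 < e by rewrite lt_min e10.
  have Fe : F (A *m x0 + e *: (A *m x0 - u)).
    by apply: H1 => //; rewrite ge_min lexx.
  have [|k' kx' _] := gauge_finP gk (x := x0 + e *: (x0 - t^-1 *: x)).
    by apply: H2 => //; rewrite ge_min lexx orbT.
  have te0 : 0 < t / e by exact: divr_gt0.
  exists (t / e * (k' - p)).
  have -> : - (A *m x - t *: u) = t / e *: (A *m (x0 + e *: (x0 - t^-1 *: x)) -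
      1 *: (A *m x0 + e *: (A *m x0 - u))).
    rewrite scale1r mulmxDr -scalemxAr mulmxBr -scalemxAr.
    rewrite [in RHS]opprD [X in t / e *: X]addrACA subrr add0r -scalerBr.
    have sub_subl (X Y Z : 'cV[R]_m) : X - Y - (X - Z) = Z - Y.
      by rewrite opprB addrC addrA subrK.
    rewrite sub_subl scalerA divfK ?lt0r_neq0// scalerBr scalerA.
    by rewrite divff ?lt0r_neq0// scale1r opprB.
  apply: KZ => //.
  exists 1, (A *m x0 + e *: (A *m x0 - u)), (x0 + e *: (x0 - t^-1 *: x)), k'.
  by split=> //; rewrite mul1r.
have Hu u : F u -> p <= dotp u w.
  move=> Fu; have : dotp (A *m 0 - 1 *: u) w <= 0 - 1 * p.
    by apply: Hw; exists 1, u, 0, 0; split=> //; exact: gauge_0.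
  by rewrite mulmx0 dotpBl dotp0l dotpZl => H; lra.
exists w; split=> // x k kx.
have c0 := Hu _ F0; pose c := dotp (A *m x0) w - p.
(* [K] only contains pairs with [t > 0], so [t = 0] is approached by [t = e / (c + 1)] with
   [u = A x0]; the resulting error [t * c] is at most [e]. *)
have c1 : 0 < c + 1 by rewrite /c; lra.
apply/ler_addgt0Pr => e e0.
have te0 : 0 < e / (c + 1) by exact: divr_gt0.
have : dotp (A *m x - e / (c + 1) *: (A *m x0)) w <= k - e / (c + 1) * p.
  by apply: Hw; exists (e / (c + 1)), (A *m x0), x, k; split.
rewrite dotpBl dotpZl => H.
have : e / (c + 1) * c <= e.
  by rewrite mulrAC -mulrA ler_piMr ?(ltW e0)// ler_pdivrMr// mul1r lerDl.
rewrite {2}/c mulrBr => H'; lra.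
Qed.

(** * Strong duality and the optimality conditions *)

Theorem theorem3p6 (R : realType) (m n : nat)
  (kappa : 'cV[R]_n -> \bar R) (rho : 'cV[R]_m -> \bar R)
  (A : 'M[R]_(m, n)) (b : 'cV[R]_m) (sigma : R)
  (hkappa : closed_gauge kappa) (hrho : closed_gauge rho)
  (hsigma : 0 <= sigma) (hb : (sigma%:E < rho b)%E)
  (hp : primal_relatively_strictly_feasible kappa rho A b sigma)
  (hd : dual_relatively_strictly_feasible kappa rho A b sigma)
  (x : 'cV[R]_n) (y : 'cV[R]_m)
  (hxy : primal_dual_feasible kappa rho A b sigma x y) :
  (primal_optimal kappa rho A b sigma x /\ dual_optimal kappa rho A b sigma y)
  <->
  [/\ rho (b - A *m x) = sigma%:E \/ polar rho y = 0%E,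
      ((dotp b y)%:E - scaled_polar sigma rho y = 1)%E,
      (dotp x (A^T *m y))%:E = (kappa x * polar kappa (A^T *m y))%E
    & (dotp (b - A *m x) y)%:E = scaled_polar sigma rho y].
Proof.
have [gk _] := hkappa; have [gr _] := hrho.
have [dx Fx Fy dy] := hxy.
have [k kx k0] := gauge_finP gk dx.
have [q qy q0] := polar_finP dy.
have [s sy sb] := Fd_finP hsigma Fy.
have weak z w k' q' : Fp rho b sigma (A *m z) -> Fd rho b sigma w ->
    kappa z = k'%:E -> polar kappa (A^T *m w) = q'%:E -> 1 <= k' * q'.
  move=> Fz Fw kz qw.
  apply: le_trans (dotp_le_polar gk kz qw).
  exact: dual_feasible_dotp_ge1 Fz Fw.
have kq1 := weak _ _ _ _ Fx Fy kx qy.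
have kpos : 0 < k by nra.
have qpos : 0 < q by nra.
have dxy := dual_feasible_dotp_ge1 hrho hsigma Fx Fy.
have dres := dotp_le_scaled_polar hrho hsigma y Fx.
rewrite sy kx qy -EFinM -EFinB lee_fin in dres *.
split=> [[[_ ox] [_ oy]]|[_ [cb] [cc] [cd]]]; last first.
  (* (b) and (d) give [dotp (A *m x) y = 1], and (c) turns this into [k * q = 1]; weak duality
     against any competitor then yields both optimalities. *)
  have kq : k * q = 1.
    by rewrite -cc -dotp_mulmx; move: cd cb; rewrite dotpBl => cd cb; lra.
  split; split=> // z Fz.
  - rewrite kx; have := gauge_ge0 gk z.
    case kz : (kappa z) => [k'| |]; rewrite ?leey//.
    rewrite !lee_fin => _; rewrite -(ler_pM2r qpos) kq.
    exact: weak Fz Fy kz qy.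
  - rewrite qy; have := polar_ge0 (f := kappa) (A^T *m z).
    case qz : (polar kappa (A^T *m z)) => [q'| |]; rewrite ?leey//.
    rewrite !lee_fin => _; rewrite -(ler_pM2l kpos) kq.
    exact: weak Fx Fz kx qz.
have kq : k * q = 1.
  have [x0 [/= rx0 rkx0]] := hp.
  (* Optimality of [x] makes [k] the primal value. The rescaled multiplier [w / k] is dual feasible
     with value at most [1 / k], so optimality of [y] forces [q <= 1 / k]. *)
  have [|z /ox|w [Hw HF]] := gauge_multiplier (p := k) gk _ rx0 rkx0.
  - move=> u v t t0 t1 Fu Fv.
    rewrite /Fp /= (_ : b - _ = t *: (b - u) + (1 - t) *: (b - v)).
      exact: gauge_le_convex.
    by rewrite !scalerBr addrACA -scalerDl [t + _]addrC subrK scale1r opprD.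
  - by rewrite kx.
  apply/le_anti; rewrite kq1 andbT.
  have Fw : Fd rho b sigma (k^-1 *: w).
    apply/Fd_supportP => // v rv.
    have : k <= dotp (b - v) w by apply: HF; rewrite /Fp /= subKr.
    rewrite dotpBl => kbv; rewrite !dotpZr -(ler_pM2l kpos) mulrBr.
    by rewrite !mulrA divff ?lt0r_neq0// !mul1r mulr1; lra.
  have polar_w : (polar kappa (A^T *m (k^-1 *: w)) <= (k^-1)%:E)%E.
    apply: polar_le => // [|z r kz]; first by rewrite invr_ge0.
    by rewrite -dotp_mulmx dotpZr ler_pM2l ?invr_gt0//; exact: Hw.
  have := le_trans (oy _ Fw) polar_w; rewrite qy lee_fin => qk.
  by rewrite -ler_pdivlMl ?mulr1.
have dle : dotp x (A^T *m y) <= k * q by exact: (dotp_le_polar gk kx qy).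
rewrite dotpBl dotp_mulmx in dres *.
(* The chain [1 <= dotp b y - s <= dotp x (A^T y) <= k * q = 1] collapses to equalities, which are
   (b), (c) and (d). *)
split; [|congr EFin; lra|congr EFin; lra|congr EFin; lra].
have [r rx /andP[r0 rs]] := gauge_le_finP gr Fx.
move: sy; rewrite /scaled_polar; case: eqVneq => [s0 _|sn0 sy].
  by left; rewrite rx; congr EFin; apply/le_anti; rewrite rs s0.
have spos : 0 < sigma by rewrite lt0r sn0.
(* An infinite polar times [sigma > 0] would contradict finiteness of [s]. *)
have [q' qy' q0'] : exists2 q', polar rho y = q'%:E & 0 <= q'.
  apply: polar_finP; move: sy; have := polar_ge0 (f := rho) y.
  case: (polar rho y) => [q'| |]// _; first by rewrite ltry.
  by rewrite gt0_muley.
move: sy; rewrite qy' -EFinM => -[sE].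
move: q0'; rewrite le0r => /orP[/eqP ->|q0']; [by right|left].
(* By (d), [sigma * q' = s = dotp (b - A x) y <= r * q']; cancelling [q' > 0] gives [sigma <= r]. *)
rewrite rx; congr EFin; apply/le_anti; rewrite rs /= -(ler_pM2r q0') sE.
have := dotp_le_polar gr rx qy'; rewrite dotpBl dotp_mulmx => H; lra.
Qed.
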